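(* Let $N$ be a complete CAT(0)-space and let $(X,d_X,\mu_X)$ and $(Y,d_Y,\mu_Y)$ be two mm-spaces. Let $f:X\times Y\to N$ be a uniformly continuous map such that the push-forward measure $f_{*}(\mu_X\times\mu_Y)$ has finite moment of order $1$. Then $$d_N\big(\mathbb{E}(f),\mathbb{E}_y(\mathbb{E}(f^y))\big)\le V_1(f)$$ and $$d_N\big(\mathbb{E}(f),\mathbb{E}_y(\mathbb{E}(f^y))\big)\le \frac{1}{\sqrt{3}}\,V_2(f).$$
   Context: An mm-space is a triple $(X,d_X,\mu_X)$ where $d_X$ is a complete separable metric on the set $X$ and $\mu_X$ is a Borel probability measure on $X$ with full support. The product $X\times Y$ of two mm-spaces carries the $\ell_2$-distance $\sqrt{d_X(x,x')^2+d_Y(y,y')^2}$ and the product measure $\mu_X\times\mu_Y$, and is again an mm-space. A geodesic in a metric space is a rectifiable curve $\gamma:[0,1]\to N$ of constant speed whose length equals $d_N(\gamma(0),\gamma(1))$; a geodesic metric space is one in which any two points are joined by a geodesic. A CAT(0)-space is a geodesic metric space $N$ such that $d_N(x,\gamma(1/2))^2\le \frac12 d_N(x,y)^2+\frac12 d_N(x,z)^2-\frac14 d_N(y,z)^2$ for all $x,y,z\in N$ and every geodesic $\gamma:[0,1]\to N$ from $y$ to $z$. $\mathcal{P}_1(N)$ denotes the set of Borel probability measures $\nu$ on $N$ with separable support and finite moment of order $1$, i.e. $\int_N d_N(x,y)\,d\nu(y)<\infty$ for some (hence all) $x\in N$. The center of mass $c(\nu)$ of $\nu\in\mathcal{P}_1(N)$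 is the unique minimizer of $x\mapsto \int_N\{d_N(x,y)^2-d_N(z,y)^2\}\,d\nu(y)$, which does not depend on the choice of $z\in N$; it exists in every complete CAT(0)-space. For a measurable map $Z$ from a probability space $(\Omega,\mathcal{A},\mathbb{P})$ to $N$ with $Z_*\mathbb{P}\in\mathcal{P}_1(N)$, its expectation is $\mathbb{E}(Z):=c(Z_*\mathbb{P})$. For $f:X\times Y\to N$ and $y\in Y$, let $f^y:X\to N$, $f^y(x):=f(x,y)$, and $g_f(y):=\mathbb{E}(f^y)$ (with respect to $\mu_X$). For $f$ uniformly continuous with $f_*(\mu_X\times\mu_Y)$ of finite moment of order $1$, one has $(f^y)_*\mu_X\in\mathcal{P}_1(N)$ for every $y\in Y$, the map $g_f:Y\to N$ is Borel measurable, and $(g_f)_*\mu_Y\in\mathcal{P}_1(N)$. The repeated integral is $\mathbb{E}_y(\mathbb{E}(f^y)):=\mathbb{E}(g_f)$ (with respect to $\mu_Y$), and $\mathbb{E}(f)$ is taken with respect to $\mu_X\times\mu_Y$. For $p\ge1$, an mm-space $W$ and a Borel map $h:W\to N$, the $L^p$-variation is $V_p(h):=\big(\iint_{W\times W}d_N(h(w),h(w'))^p\,d\mu_W(w)\,d\mu_W(w')\big)^{1/p}\in[0,+\infty]$; here it is applied with $W=X\times Y$. *)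

(* Defs.v *)
From HB Require Import structures.
From mathcomp Require Import all_boot all_order all_algebra.
From mathcomp Require Import all_classical all_reals all_analysis.
From mathcomp Require Import lra.
Set Implicit Arguments.
Unset Strict Implicit.
Unset Printing Implicit Defensive.
Import Order.TTheory GRing.Theory Num.Theory.
Import numFieldNormedType.Exports.
Local Open Scope classical_set_scope.
Local Open Scope ring_scope.

(* [completeType] carries a base point, so these spaces are nonempty. *)
#[short(type="completeMetricType")]
HB.structure Definition CompleteMetric (R : numDomainType) :=
  {T of Complete T & Metric R T}.

Definition borel (T : ptopologicalType) := g_sigma_algebraType (@open T).

Definition separable (T : topologicalType) :=
  exists2 D : set T, countable D & dense D.

Definition measure_support (R : realType) (T : ptopologicalType)
    (mu : set (borel T) -> \bar R) : set T :=
  [set x | forall U : set T, open U -> U x -> (0 < mu U)%E].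

Record mmSpace (R : realType) := MMSpace {
  mm_carrier :> completeMetricType R ;
  mm_measure : probability (borel mm_carrier) R ;
  mm_separable : separable mm_carrier ;
  mm_full_support : measure_support mm_measure = setT }.

Section l2_product.
Variables (R : realType) (X Y : metricType R).

(* An alias of [X * Y], whose own uniform structure in the library comes from
   the sup distance. *)
Definition l2prod : Type := (X * Y)%type.

HB.instance Definition _ := Choice.on l2prod.

Definition l2dist (p q : l2prod) : R :=
  Num.sqrt (mdist p.1 q.1 ^+ 2 + mdist p.2 q.2 ^+ 2).

Let l2distxx p : l2dist p p = 0.
Proof. by rewrite /l2dist !mdistxx expr0n addr0 sqrtr0. Qed.

Let l2dist_positivity p q : l2dist p q = 0 -> p = q.
Proof.
move=> /eqP; rewrite sqrtr_eq0 => h.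
have h1 : mdist p.1 q.1 ^+ 2 = 0.
  apply/eqP; rewrite eq_le sqr_ge0 andbT (le_trans _ h)//.
  by rewrite lerDl sqr_ge0.
have h2 : mdist p.2 q.2 ^+ 2 = 0.
  apply/eqP; rewrite eq_le sqr_ge0 andbT (le_trans _ h)//.
  by rewrite lerDr sqr_ge0.
move/eqP: h1; move/eqP: h2; rewrite !sqrf_eq0.
move=> /eqP/mdist_positivity h2 /eqP/mdist_positivity h1.
by rewrite (surjective_pairing p) (surjective_pairing q) h1 h2.
Qed.

Let l2dist_sym p q : l2dist p q = l2dist q p.
Proof. by rewrite /l2dist metric_sym [mdist p.2 _]metric_sym. Qed.

Let sqrt_minkowski (a b c d : R) :
  Num.sqrt ((a + c) ^+ 2 + (b + d) ^+ 2) <=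
  Num.sqrt (a ^+ 2 + b ^+ 2) + Num.sqrt (c ^+ 2 + d ^+ 2).
Proof.
set u := Num.sqrt (a ^+ 2 + b ^+ 2); set v := Num.sqrt (c ^+ 2 + d ^+ 2).
have u0 : 0 <= u by exact: sqrtr_ge0.
have v0 : 0 <= v by exact: sqrtr_ge0.
have u2 : u ^+ 2 = a ^+ 2 + b ^+ 2 by rewrite sqr_sqrtr// addr_ge0 ?sqr_ge0.
have v2 : v ^+ 2 = c ^+ 2 + d ^+ 2 by rewrite sqr_sqrtr// addr_ge0 ?sqr_ge0.
rewrite -[leRHS]ger0_norm ?addr_ge0// -sqrtr_sqr ler_wsqrtr//.
suff : a * c + b * d <= u * v by lra.
rewrite (le_trans (ler_norm _))// -[leRHS]ger0_norm ?mulr_ge0//.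
rewrite -ler_sqr ?nnegrE// !real_normK ?num_real// exprMn u2 v2.
have := sqr_ge0 (a * d - b * c); lra.
Qed.

Let l2dist_triangle q p r : l2dist p r <= l2dist p q + l2dist q r.
Proof.
apply: le_trans (sqrt_minkowski _ _ _ _); rewrite ler_wsqrtr// lerD//;
  by rewrite ler_sqr ?nnegrE ?addr_ge0 ?mdist_ge0// metric_triangle.
Qed.

HB.instance Definition _ := @isMetric.Build R l2prod l2dist
  l2distxx l2dist_positivity l2dist_sym l2dist_triangle.

End l2_product.

(* The l2 distance on X * Y induces the product topology and X, Y are separable,
   so the product sigma-algebra is the Borel sigma-algebra of [l2prod X Y]. *)
Definition mm_prod_measure (R : realType) (X Y : mmSpace R) :
    probability (borel X * borel Y)%type R :=
  (mm_measure X \x mm_measure Y)%E.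

Section curves.
Variables (R : realType) (N : metricType R).
Implicit Types (g : R -> N) (s t : R).

Definition curve_length s t g : \bar R :=
  ereal_sup [set (\sum_(0 <= i < size l)
      mdist (g (nth s (s :: l) i)) (g (nth s (s :: l) i.+1)))%:E
    | l in itv_partition s t].

Definition constant_speed g := exists2 v : R, 0 <= v &
  forall s t, 0 <= s -> s <= t -> t <= 1 ->
    curve_length s t g = (v * (t - s))%:E.

(* Curves [0, 1] -> N are maps R -> N of which only the restriction to [0, 1]
   matters. *)
Definition geodesic g :=
  [/\ {within `[0, 1], continuous g},
      (curve_length 0 1 g < +oo)%E,
      constant_speed g &
      curve_length 0 1 g = (mdist (g 0) (g 1))%:E].

Definition geodesic_space :=
  forall y z : N, exists g, [/\ geodesic g, g 0 = y & g 1 = z].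

Definition CAT0 := geodesic_space /\
  forall (x y z : N) g, geodesic g -> g 0 = y -> g 1 = z ->
    mdist x (g (1 / 2)) ^+ 2 <=
      1 / 2 * mdist x y ^+ 2 + 1 / 2 * mdist x z ^+ 2
      - 1 / 4 * mdist y z ^+ 2.

End curves.

Section center_of_mass.
Variables (R : realType) (N : completeMetricType R).
Implicit Types nu : set (borel N) -> \bar R.
Local Open Scope ereal_scope.

(* Measures on N are given by their values, as a pushforward is a bundled
   measure only once the map is known to be measurable. *)
Definition finite_moment1 nu :=
  exists x : N, \int[nu]_(y in [set: borel N]) (mdist x (y : N))%:E < +oo.

Definition cm_functional nu (z x : N) : \bar R :=
  \int[nu]_(y in [set: borel N])
    (mdist x (y : N) ^+ 2 - mdist z (y : N) ^+ 2)%:E.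

Definition cm_minimizers nu : set N :=
  [set c | forall z x, cm_functional nu z c <= cm_functional nu z x].

(* The unique minimizer, which exists when N is CAT(0) and nu has separable
   support and finite first moment; otherwise an unspecified default. *)
Definition center_of_mass nu : N := get [set c | cm_minimizers nu = [set c]].

Definition cm_expectation d (T : measurableType d) (P : probability T R)
    (Z : T -> borel N) : N :=
  center_of_mass (pushforward P Z).

End center_of_mass.

Definition Lp_variation (R : realType) (N : metricType R) d (W : measurableType d)
    (mu : probability W R) (p : R) (h : W -> N) : \bar R :=
  ((\int[mu]_(w in [set: W]) \int[mu]_(w' in [set: W])
      (mdist (h w) (h w') `^ p)%:E) `^ p^-1)%E.

(* Main.v *)
Require Import Defs.
From mathcomp Require Import all_boot all_order all_algebra.
From mathcomp Require Import all_classical all_reals all_analysis.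
From mathcomp Require Import measurable_realfun.
From mathcomp Require Import ring lra.
Import Order.TTheory GRing.Theory Num.Theory.
Import numFieldNormedType.Exports.
Local Open Scope classical_set_scope.
Local Open Scope ring_scope.
Set Implicit Arguments.
Unset Strict Implicit.
Unset Printing Implicit Defensive.

(** Two facts about the center of mass [c] of a measure [nu] on [N] suffice.
    The variance inequality
      [d(c, z)^2 + int d(c, y)^2 dnu(y) <= int d(z, y)^2 dnu(y)]
    follows by comparing [c] with the points [p] at parameters [t = 2^-n] of a
    segment from [c] to [z]: the functional being minimized is at least as large
    at [p] as at [c], the CAT(0) inequality bounds it from above at [p], and one
    divides by [t] and lets [t] go to 0 ([variance_inequality]).  The Jensen
    inequality [d(c, z) <= int d(z, y) dnu(y)] uses the same points: the
    difference quotient of [d(p, y)^2] at [c] is, in the limit, [-2 a b cos],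
    where [a = d(c, z)], [b = d(c, y)] and the angle is the one at [c]; by the
    law of cosines it is at most [2 a (d(z, y) - a)], and its integral is
    nonnegative because [c] is a minimizer ([mdist_center_le_mean]).

    Write [c] and [e] for the simple and the repeated expectation, [g(y)] for
    the expectation of [f^y], and [D = d(c, e)].  Applying Jensen to [g], then
    to every [f^y], then to [f] itself,
      [D <= int d(c, g) <= int d(c, f) <= V_1(f)].
    For the second bound, the variance inequality for [f], for [g] and for every
    [f^y] gives
      [D^2 + int d(c, f)^2 <= int d(e, f)^2],
      [D^2 + int d(e, g)^2 <= int d(c, g)^2],
      [int d(c, g)^2 + int d(g, f)^2 <= int d(c, f)^2],
    and [d(e, f)^2 <= 2 d(e, g)^2 + 2 d(g, f)^2] combines them into
    [3 D^2 <= int d(c, f)^2] ([mdist_expectations_le_second_moment]).  The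
    variance inequality at the points [z = f(w)] bounds the right-hand side by
    [V_2(f)^2].

    What remains is to make these expectations meaningful.  Centers exist
    because the CAT(0) inequality makes any minimizing filter Cauchy
    ([center_exists]).  The map [f] is measurable for the product
    sigma-algebra because [X] and [Y] are separable
    ([open_l2prod_measurable]).  Every fiber [f^y] is integrable: by Fubini
    almost all are, the full support of [mu_Y] makes the good [y] dense, and
    uniform continuity transfers integrability between nearby fibers
    ([integrable_l2prod_section]).  Finally [g] is continuous, hence measurable,
    because the center depends continuously on the map for the uniform distance
    ([center_stability]). *)

(** * Integration *)

(** The integral of a nonnegative function is a supremum over the simple
    functions below it, so monotonicity holds without measurability.  This
    allows to bound from below the iterated integrals of [d(f(w), f(w'))]
    without first showing that the inner integral is measurable. *)
Lemma ge0_le_integral_sup d (T : measurableType d) (R : realType)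
    (mu : {measure set T -> \bar R}) (f g : T -> \bar R) :
  (forall x, 0 <= f x)%E -> (forall x, f x <= g x)%E ->
  (\int[mu]_x f x <= \int[mu]_x g x)%E.
Proof.
move=> f0 fg; have g0 x : (0 <= g x)%E by exact: le_trans (fg x).
rewrite !ge0_integralTE//; apply: ereal_sup_le => _ [h hf <-].
by exists h => // x; exact: le_trans (fg x).
Qed.

Lemma integral_cst_probability d (T : measurableType d) (R : realType)
    (P : probability T R) (r : \bar R) : (\int[P]_x r = r)%E.
Proof. by rewrite integral_cst//= probability_setT mule1. Qed.

Lemma Rintegral_cst_probability d (T : measurableType d) (R : realType)
    (P : probability T R) (r : R) : \int[P]_x r = r.
Proof. by rewrite Rintegral_cst//= probability_setT mulr1. Qed.

Lemma integrable_EFin_cst d (T : measurableType d) (R : realType)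
    (P : probability T R) (r : R) : P.-integrable setT (fun=> r%:E).
Proof. exact: finite_measure_integrable_cst. Qed.

Lemma le_dyadic_limit (R : archiRealFieldType) (u v k : R) :
  (forall n, u <= v + 2^-1 ^+ n * k) -> u <= v.
Proof.
move=> H; apply/ler_addgt0Pr => e e0; pose n := Num.bound (k / e).
have kn : k / e < 2 ^+ n by exact: upper_nthrootP.
apply: (le_trans (H n)); rewrite lerD2l exprVn mulrC ler_pdivrMr ?exprn_gt0//.
by rewrite mulrC -ler_pdivrMr// ltW.
Qed.

(** * Metric spaces *)

Lemma mdist_lip (R : realType) (M : metricType R) (x y z : M) :
  `|mdist x z - mdist y z| <= mdist x y.
Proof.
have := metric_triangle x y z; have := metric_triangle y x z.
by rewrite (metric_sym y x) ler_norml; lra.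
Qed.

Lemma sqr_dist_diff (R : realType) (M : metricType R) (x z r : M) :
  `|mdist x r ^+ 2 - mdist z r ^+ 2| <= mdist x z * (2 * mdist z r + mdist x z).
Proof.
rewrite subr_sqr normrM ler_pM// ?mdist_lip//.
rewrite ger0_norm ?addr_ge0 ?mdist_ge0//.
by have := metric_triangle x z r; lra.
Qed.

Lemma open_mdistP (R : realType) (M : metricType R) (U : set M) :
  open U <-> forall x, U x ->
    exists2 e : R, 0 < e & forall y, mdist x y < e -> U y.
Proof.
rewrite openE; split => [oU x /oU/nbhs_ballP[e /= e0 H]|H x /H[e e0 xeU]].
  by exists e => // y xy; apply: H; rewrite ballEmdist.
by apply/nbhs_ballP; exists e => // y; rewrite ballEmdist; exact: xeU.
Qed.

Lemma dense_mdist (R : realType) (M : metricType R) (D : set M) (x : M) (e : R) :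
  dense D -> 0 < e -> exists2 p, D p & mdist p x < e.
Proof.
move=> dD e0; have [||p [xp Dp]] := dD [set p | mdist p x < e].
- by exists x; rewrite /= mdistxx.
- apply/open_mdistP => y /= yx; exists (e - mdist y x); first by rewrite subr_gt0.
  by move=> z yz /=; have := metric_triangle z y x; rewrite (metric_sym z y); lra.
- by exists p.
Qed.

Lemma borel_open (M : ptopologicalType) (U : set M) :
  open U -> measurable (U : set (borel M)).
Proof. by move=> oU; exact: sub_sigma_algebra. Qed.

Lemma measurable_to_borel d (T : measurableType d) (M : ptopologicalType)
    (h : T -> M) : (forall U : set M, open U -> measurable (h @^-1` U)) ->
  measurable_fun setT (h : T -> borel M).
Proof.
move=> H; apply: (@measurability _ _ _ (borel M) setT h (@open M)) => //.
by move=> _ [U oU <-]; rewrite setTI; exact: H.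
Qed.

Lemma measurable_mdist (R : realType) (M : completeMetricType R) (x : M) :
  measurable_fun setT (fun y : borel M => mdist x (y : M)).
Proof.
apply: (measurability _ (RGenOInfty.measurableE R)).
move=> _ [_ [r ->] <-]; rewrite setTI; apply: borel_open.
apply/open_mdistP => y; rewrite /= in_itv/= andbT => rxy.
exists (mdist x y - r); first by rewrite subr_gt0.
move=> z yz; rewrite /= in_itv/= andbT.
by have := metric_triangle x z y; rewrite (metric_sym z y); lra.
Qed.

Lemma measurable_mball (R : realType) (M : completeMetricType R) (x : M) (r : R) :
  measurable ([set y | mdist x y < r] : set (borel M)).
Proof.
apply: borel_open; apply/open_mdistP => y /= xy.
exists (r - mdist x y); first by rewrite subr_gt0.
by move=> z yz /=; have := metric_triangle x y z; lra.
Qed.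

(** * CAT(0) spaces *)

(** The inequality satisfied by the point [p] at parameter [t] of the segment
    from [c] to [z]; in the Euclidean plane it is Stewart's identity.  All the
    geometry used below goes through such points rather than through curves. *)
Definition CAT0_ineq (R : realType) (N : metricType R) (c z : N) (t : R) (p : N) :=
  forall y, mdist p y ^+ 2 <= (1 - t) * mdist c y ^+ 2 + t * mdist z y ^+ 2
                              - t * (1 - t) * mdist c z ^+ 2.

Lemma CAT0_midpoint (R : realType) (N : metricType R) : CAT0 N ->
  forall c z : N, exists p, CAT0_ineq c z 2^-1 p.
Proof.
move=> [geo cat] c z; have [g [gg g0 g1]] := geo c z.
exists (g (1 / 2)) => y; have := cat y c z g gg g0 g1.
rewrite (metric_sym _ y) (metric_sym c y) (metric_sym z y).
lra.
Qed.

(** The midpoint [q] of [c] and [p] works: its inequality contains the term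
    [- d(c, p)^2 / 4], for which [d(c, p) >= t d(c, z)] is needed; this comes from
    [CAT0_ineq] for [p] at [z], which gives [d(p, z) <= (1 - t) d(c, z)]. *)
Lemma CAT0_ineq_half (R : realType) (N : metricType R) : CAT0 N ->
  forall (c z p : N) t, 0 <= t <= 1 -> CAT0_ineq c z t p ->
  exists q, CAT0_ineq c z (t / 2) q.
Proof.
move=> catN c z p t /andP[t0 t1] pt; have [q qp] := CAT0_midpoint catN c p.
exists q => y; have := qp y; have := pt y.
have cp : (t * mdist c z) ^+ 2 <= mdist c p ^+ 2.
  have : mdist p z <= (1 - t) * mdist c z.
    rewrite -ler_sqr ?nnegrE ?mulr_ge0 ?mdist_ge0 ?subr_ge0//.
    by have := pt z; rewrite mdistxx; lra.
  move=> pz; rewrite ler_sqr ?nnegrE ?mulr_ge0 ?mdist_ge0//.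
  by have := metric_triangle c p z; lra.
lra.
Qed.

Lemma CAT0_ineq_dyadic (R : realType) (N : metricType R) : CAT0 N ->
  forall (c z : N) n, exists p, CAT0_ineq c z (2^-1 ^+ n) p.
Proof.
move=> catN c z; elim=> [|n [p IH]].
  by exists z => y; rewrite expr0; lra.
rewrite exprSr; apply: CAT0_ineq_half IH => //.
by rewrite exprn_ge0//= exprn_ile1// invf_le1//; lra.
Qed.

(** Here [a], [b], [e] are the sides [d(c, z)], [d(c, y)], [d(z, y)] of a
    triangle, and [2 a u] is the difference quotient of the squared distance to
    [y] from [c] to the point at parameter [s^2] of the segment towards [z], so
    that [u] approximates [- b cos] of the angle at [c].  The last hypothesis is
    a perturbed law of cosines; with [|u| <= b] it gives [(a + u)^2 <= e^2] in
    the limit [s = 0].  The parameter is the square [s^2] because the error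
    enters under a square root. *)
Lemma law_of_cosines_bound (R : realFieldType) (a b e s u : R) :
  0 < a -> 0 <= b -> 0 <= e -> 0 < s -> s <= 1 ->
  `|u| <= b + s ^+ 2 * a / 2 ->
  b ^+ 2 + (1 - s ^+ 2) * a ^+ 2 + 2 * a * u <= e ^+ 2 ->
  a + u <= e + s * (2 * a + b).
Proof.
move=> a0 b0 e0 s0 s1 ub eu; rewrite leNgt; apply/negP => lt_eu.
have ab0 : 0 <= 2 * a + b by lra.
have sab0 : 0 <= s * (2 * a + b) by rewrite mulr_ge0// ltW.
have : (e + s * (2 * a + b)) ^+ 2 < (a + u) ^+ 2.
  by rewrite ltr_sqr ?nnegrE; lra.
have u2 : u ^+ 2 <= (b + s ^+ 2 * a / 2) ^+ 2.
  by rewrite -real_normK ?num_real// ler_sqr// nnegrE (le_trans _ ub).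
have := mulr_ge0 e0 sab0.
have s2 : s ^+ 2 <= 1 by rewrite exprn_ile1// ltW.
have : s ^+ 2 * (a ^+ 2 + a * b + s ^+ 2 * a ^+ 2 / 4) <= s ^+ 2 * (2 * a + b) ^+ 2.
  rewrite ler_pM2l ?exprn_gt0//.
  have : s ^+ 2 * a ^+ 2 <= a ^+ 2 by rewrite ler_piMl// sqr_ge0.
  have := mulr_ge0 (ltW a0) b0; have := sqr_ge0 a; have := sqr_ge0 b; lra.
lra.
Qed.

(** * Centers of mass *)

Section center.
Context d (T : measurableType d) (R : realType) (P : probability T R)
  (N : completeMetricType R).
Implicit Types (h : T -> N) (c x y z : N).

Definition integrable_map h :=
  measurable_fun setT (h : T -> borel N) /\
  forall x, P.-integrable setT (fun w => (mdist x (h w))%:E).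

(** The function minimized by the center, for the law of [h]; as in
    [cm_functional], subtracting the squared distance to [z] makes it finite
    under a first moment condition alone. *)
Definition energy h z x : R :=
  \int[P]_w (mdist x (h w) ^+ 2 - mdist z (h w) ^+ 2).

Definition is_center h c := forall x, 0 <= energy h c x.

Lemma measurable_mdist_comp h x : measurable_fun setT (h : T -> borel N) ->
  measurable_fun setT (fun w => mdist x (h w)).
Proof. by move=> mh; exact: (measurableT_comp (measurable_mdist x)). Qed.

Lemma integrable_mapP h : measurable_fun setT (h : T -> borel N) ->
  (exists x, (\int[P]_w (mdist x (h w))%:E < +oo)%E) -> integrable_map h.
Proof.
move=> mh [x hx]; split => // y.
have ix : P.-integrable setT (fun w => (mdist x (h w))%:E).
  apply/integrableP; split; first exact/measurable_EFinP/measurable_mdist_comp.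
  by under eq_integral do rewrite gee0_abs ?lee_fin ?mdist_ge0//.
apply: (le_integrable measurableT _ _
  (integrableD measurableT (integrable_EFin_cst P (mdist y x)) ix)).
  exact/measurable_EFinP/measurable_mdist_comp.
move=> w _ /=; rewrite lee_fin !ger0_norm ?addr_ge0 ?mdist_ge0//.
exact: metric_triangle.
Qed.

Section fixed_map.
Variables (h : T -> N) (ih : integrable_map h).

Let mh x : measurable_fun setT (fun w => mdist x (h w)).
Proof. exact/measurable_mdist_comp/ih.1. Qed.

Lemma integrable_sqr_dist_diff z x :
  P.-integrable setT (fun w => (mdist x (h w) ^+ 2 - mdist z (h w) ^+ 2)%:E).
Proof.
have i1 : P.-integrable setT (fun w =>
    ((mdist x z)%:E * ((2%:E * (mdist z (h w))%:E) + (mdist x z)%:E))%E).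
  apply: integrableZl => //; apply: integrableD => //.
    by apply: integrableZl => //; exact: ih.2.
  exact: integrable_EFin_cst.
apply: (le_integrable measurableT _ _ i1).
  by apply/measurable_EFinP; apply: measurable_funB; exact: measurable_funX.
move=> w _ /=; rewrite lee_fin; apply: le_trans (ler_norm _).
exact: sqr_dist_diff.
Qed.

Lemma cm_functionalE z x :
  cm_functional (pushforward P (h : T -> borel N)) z x = (energy h z x)%:E.
Proof.
rewrite /cm_functional (@integral_pushforward _ _ _ (borel N) _ h ih.1)//.
- by rewrite preimage_setT fineK// integrable_fin_num// integrable_sqr_dist_diff.
- apply/measurable_EFinP; apply: measurable_funB; apply: measurable_funX;
    exact: measurable_mdist.
- by rewrite preimage_setT; exact: integrable_sqr_dist_diff.
Qed.

Lemma energyD z c x : energy h z x = energy h z c + energy h c x.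
Proof.
rewrite /energy -RintegralD//; try exact: integrable_sqr_dist_diff.
by congr fine; apply: eq_integral => w _; congr EFin; ring.
Qed.

Lemma energyxx z : energy h z z = 0.
Proof. by apply: (@addrI _ (energy h z z)); rewrite -energyD addr0. Qed.

Definition mean_dist z : R := \int[P]_w mdist z (h w).

Lemma mean_distE z : (\int[P]_w (mdist z (h w))%:E)%E = (mean_dist z)%:E.
Proof. by rewrite fineK// integrable_fin_num//; exact: ih.2. Qed.

Lemma mean_dist_ge0 z : 0 <= mean_dist z.
Proof. by apply: Rintegral_ge0 => w _; exact: mdist_ge0. Qed.

Lemma integrable_affine_dist z (a b : R) :
  P.-integrable setT (fun w => (a * mdist z (h w) + b)%:E).
Proof.
under eq_fun do rewrite EFinD EFinM.
apply: integrableD => //; last exact: integrable_EFin_cst.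
by apply: integrableZl => //; exact: ih.2.
Qed.

Lemma Rintegral_affine_dist z (a b : R) :
  \int[P]_w (a * mdist z (h w) + b) = a * mean_dist z + b.
Proof.
rewrite RintegralD//; last exact: integrable_EFin_cst.
  by rewrite RintegralZl ?Rintegral_cst_probability//; exact: ih.2.
exact: (integrableZl measurableT a (ih.2 z)).
Qed.

Lemma normr_energy_le z x :
  `|energy h z x| <= mdist x z * (2 * mean_dist z + mdist x z).
Proof.
have ie := integrable_sqr_dist_diff z x.
rewrite mulrDr mulrA -Rintegral_affine_dist.
apply: le_trans (le_normr_Rintegral measurableT ie) _; apply: le_Rintegral => //.
- exact: integrable_norm ie.
- exact: integrable_affine_dist.
by move=> w _; apply: le_trans (sqr_dist_diff _ _ _) _; lra.
Qed.

(** From [d(x, y) >= |d(z, y) - d(x, z)|], the energy is at least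
    [D^2 - 2 m D] with [D = d(x, z)] and [m] the mean distance to [z]. *)
Lemma energy_ge z x : - mean_dist z ^+ 2 <= energy h z x.
Proof.
apply: (@le_trans _ _ (- (2 * mdist x z) * mean_dist z + mdist x z ^+ 2)).
  have := sqr_ge0 (mean_dist z - mdist x z); lra.
rewrite -Rintegral_affine_dist; apply: le_Rintegral => //.
- exact: integrable_affine_dist.
- exact: integrable_sqr_dist_diff.
move=> w _.
have : (mdist z (h w) - mdist x z) ^+ 2 <= mdist x (h w) ^+ 2.
  rewrite -real_normK ?num_real// ler_sqr ?nnegrE ?mdist_ge0// ler_norml.
  have := metric_triangle x (h w) z; have := metric_triangle z x (h w).
  by rewrite (metric_sym z x) (metric_sym (h w) z); lra.
lra.
Qed.

Lemma energy_CAT0_ineq c z t p : CAT0_ineq c z t p ->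
  energy h c p <= t * energy h c z - t * (1 - t) * mdist c z ^+ 2.
Proof.
move=> pt; rewrite -[_ * mdist c z ^+ 2](Rintegral_cst_probability P).
rewrite -RintegralZl//; last exact: integrable_sqr_dist_diff.
have iZ : P.-integrable setT
    (fun w => (t * (mdist z (h w) ^+ 2 - mdist c (h w) ^+ 2))%:E).
  under eq_fun do rewrite EFinM.
  by apply: integrableZl => //; exact: integrable_sqr_dist_diff.
rewrite -RintegralB//; last exact: integrable_EFin_cst.
apply: le_Rintegral => //.
- exact: integrable_sqr_dist_diff.
- exact: (integrableB measurableT iZ (integrable_EFin_cst P _)).
by move=> w _; have := pt (h w); lra.
Qed.

Section center_inequalities.
Hypothesis catN : CAT0 N.
Variable c : N.
Hypothesis hc : is_center h c.

(** At the point [p] of parameter [t] the energy relative to [c] lies between 0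
    and [t (energy h c z - (1 - t) d(c, z)^2)]. *)
Lemma variance_inequality z : mdist c z ^+ 2 <= energy h c z.
Proof.
apply: (@le_dyadic_limit _ _ _ (mdist c z ^+ 2)) => n; set t := 2^-1 ^+ n.
have t0 : 0 < t by rewrite exprn_gt0.
have [p pt] := CAT0_ineq_dyadic catN c z n.
have : t * mdist c z ^+ 2 <= t * (energy h c z + t * mdist c z ^+ 2).
  by have := le_trans (hc p) (energy_CAT0_ineq pt); rewrite -/t; lra.
by rewrite ler_pM2l.
Qed.

(** Jensen's inequality for the distance to [z].  For a point [p] of small
    parameter [t], [law_of_cosines_bound] bounds [d(p, y)^2 - d(c, y)^2] by
    [2 a t (d(z, y) - a)] up to an integrable error of smaller order; the
    integral of the former is nonnegative. *)
Lemma mdist_center_le_mean z : mdist c z <= mean_dist z.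
Proof.
set a := mdist c z; have := mdist_ge0 c z; rewrite -/a le_eqVlt => /predU1P[<-|a0].
  exact: mean_dist_ge0.
apply: (@le_dyadic_limit _ _ _ (2 * a + mean_dist c)) => n; set s := 2^-1 ^+ n.
have s0 : 0 < s by rewrite exprn_gt0.
have s1 : s <= 1 by rewrite exprn_ile1// invf_le1//; lra.
have [p] := CAT0_ineq_dyadic catN c z (n * 2); rewrite exprM -/s.
set t := s ^+ 2 => pt.
have t0 : 0 < t by rewrite exprn_gt0.
have t1 : t <= 1 by rewrite exprn_ile1// ltW.
have cp : mdist c p <= t * a.
  have ta0 : 0 <= t * a := mulr_ge0 (ltW t0) (ltW a0).
  rewrite metric_sym -ler_sqr ?nnegrE ?mdist_ge0//.
  by have := pt c; rewrite mdistxx (metric_sym z c) -/a; lra.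
suff key y : mdist p y ^+ 2 - mdist c y ^+ 2 <=
    2 * a * t * (mdist z y + s * (2 * a + mdist c y) - a).
  have : 0 <= 2 * a * t * (mean_dist z + s * (2 * a + mean_dist c) - a).
    apply: (le_trans (hc p)).
    have -> : 2 * a * t * (mean_dist z + s * (2 * a + mean_dist c) - a) =
      \int[P]_w (2 * a * t * mdist z (h w) + 2 * a * t * (s * 2 * a - a) +
                (2 * a * t * s * mdist c (h w) + 0)).
      rewrite RintegralD//; try exact: integrable_affine_dist.
      by rewrite !Rintegral_affine_dist; ring.
    apply: le_Rintegral => //; first exact: integrable_sqr_dist_diff.
      exact: (integrableD measurableT (integrable_affine_dist _ _ _)
        (integrable_affine_dist _ _ _)).
    by move=> w _; apply: (le_trans (key (h w))); lra.
  by rewrite pmulr_rge0 ?mulr_gt0//; lra.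
have := pt y; have := sqr_dist_diff p c y; have := mdist_ge0 c y.
set r := mdist p y; set b := mdist c y; set e := mdist z y => b0 rb Hy.
pose u := (r ^+ 2 - b ^+ 2) / (2 * a * t).
have at0 : 0 < 2 * a * t by rewrite !mulr_gt0.
have uE : r ^+ 2 - b ^+ 2 = 2 * a * t * u by rewrite /u mulrC divfK// gt_eqF.
rewrite uE ler_pM2l//.
have u_le : `|u| <= b + t * a / 2.
  rewrite -(ler_pM2l at0) -[X in X * `|u|]gtr0_norm// -normrM -uE.
  apply: (le_trans rb); rewrite metric_sym.
  have : mdist c p * (2 * b + mdist c p) <= t * a * (2 * b + t * a).
    by have cp0 := mdist_ge0 c p; apply: ler_pM => //; lra.
  lra.
have eu : b ^+ 2 + (1 - t) * a ^+ 2 + 2 * a * u <= e ^+ 2.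
  rewrite -(ler_pM2l t0) -/a; move: Hy uE; rewrite -/a; lra.
suff : a + u <= e + s * (2 * a + b) by lra.
apply: law_of_cosines_bound => //; exact: mdist_ge0.
Qed.

(** If the right-hand side is finite then so are both second moments, and the
    energy is their difference. *)
Lemma variance_inequality_ereal z :
  ((mdist c z ^+ 2)%:E + \int[P]_w (mdist c (h w) ^+ 2)%:E
    <= \int[P]_w (mdist z (h w) ^+ 2)%:E)%E.
Proof.
have m2 x : measurable_fun setT (fun w => (mdist x (h w) ^+ 2)%:E).
  exact/measurable_EFinP/measurable_funX.
have [->|zoo] := eqVneq (\int[P]_w (mdist z (h w) ^+ 2)%:E)%E +oo%E.
  by rewrite leey.
have iz : P.-integrable setT (fun w => (mdist z (h w) ^+ 2)%:E).
  apply/integrableP; split=> //.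
  under eq_integral do rewrite gee0_abs ?lee_fin ?sqr_ge0//.
  by rewrite ltey.
have ic : P.-integrable setT (fun w => (mdist c (h w) ^+ 2)%:E).
  have := integrableB measurableT iz (integrable_sqr_dist_diff c z).
  by apply: eq_integrable => // w _ /=; rewrite -EFinB; congr EFin; ring.
have <- : ((energy h c z)%:E + \int[P]_w (mdist c (h w) ^+ 2)%:E)%E =
    (\int[P]_w (mdist z (h w) ^+ 2)%:E)%E.
  rewrite /energy /Rintegral fineK; last first.
    by rewrite integrable_fin_num//; exact: integrable_sqr_dist_diff.
  rewrite -integralD//; last exact: integrable_sqr_dist_diff.
  by apply: eq_integral => w _ /=; rewrite -EFinD; congr EFin; ring.
by rewrite leeD2r// lee_fin variance_inequality.
Qed.

End center_inequalities.

Section center_existence.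
Hypothesis catN : CAT0 N.

(** Two points where the energy is within [e] of its infimum are at distance at
    most [2 sqrt e], by the CAT(0) inequality at their midpoint.  So the sublevel
    sets [S e] generate a Cauchy filter; its limit is a minimizer since the energy
    is continuous. *)
Lemma center_exists : exists c, is_center h c.
Proof.
pose x0 : N := point; pose m := inf (range (energy h x0)).
have hi : has_inf (range (energy h x0)).
  split; first by exists (energy h x0 x0); exists x0.
  by exists (- mean_dist x0 ^+ 2) => _ [x _ <-]; exact: energy_ge.
have m_le x : m <= energy h x0 x by apply: ge_inf; [case: hi|exists x].
pose S e := [set x | energy h x0 x <= m + e].
have S0 e : 0 < e -> S e !=set0.
  by move=> e0; have [_ [x _ <-] /ltW xe] := inf_adherent e0 hi; exists x.
have S_small e x y : S e x -> S e y -> mdist x y ^+ 2 <= 4 * e.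
  rewrite /S /= => Sx Sy; have [p /energy_CAT0_ineq] := CAT0_midpoint catN x y.
  have := m_le p; rewrite (energyD x0 x p); move: Sy; rewrite (energyD x0 x y).
  lra.
pose F := filter_from [set e : R | 0 < e] S.
have FF : ProperFilter F.
  apply: filter_from_proper; last by move=> e; exact: S0.
  apply: filter_from_filter; first by exists 1 => /=.
  move=> i j i0 j0; exists (Num.min i j); first by rewrite /= lt_min i0.
  by move=> x; rewrite /S /= => Sx; split; apply: (le_trans Sx);
    rewrite lerD2l ge_min lexx ?orbT.
have /cauchy_cvg/cvg_ex[c Fc] : cauchy F.
  apply: cauchy_exP => e e0.
  have e2 : 0 < e ^+ 2 / 8 by rewrite divr_gt0// exprn_gt0.
  have [x Sx] := S0 _ e2; exists x; exists (e ^+ 2 / 8) => // y Sy.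
  rewrite ballEmdist /= -ltr_sqr ?nnegrE ?mdist_ge0 ?(ltW e0)//.
  by have := S_small _ _ _ Sx Sy; lra.
exists c => x; suff : energy h x0 c <= m.
  by have := m_le x; rewrite (energyD x0 c x); lra.
apply/ler_addgt0Pr => e e0.
pose k := 2 * mean_dist c + 1.
have k0 : 0 < k by rewrite ltr_wpDl// mulr_ge0// mean_dist_ge0.
pose r := Num.min 1 (e / 2 / k).
have r0 : 0 < r by rewrite lt_min ltr01 !divr_gt0.
have [] := Fc (ball c r); first exact: nbhsx_ballx.
move=> e' /= e'0 Se'.
have [y Sy] : S (Num.min e' (e / 2)) !=set0.
  by apply: S0; rewrite lt_min e'0 divr_gt0.
have {Se'} : ball c r y.
  by apply: Se'; move: Sy; rewrite /S /= => Sy; apply: (le_trans Sy);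
    rewrite lerD2l ge_min lexx.
rewrite ballEmdist /= => cy.
have {Sy} : energy h x0 y <= m + e / 2.
  by move: Sy; rewrite /S /= => Sy; apply: (le_trans Sy);
    rewrite lerD2l ge_min lexx orbT.
rewrite (energyD x0 c y).
have := normr_energy_le c y; rewrite ler_norml => /andP[+ _].
have : mdist y c * (2 * mean_dist c + mdist y c) <= e / 2.
  have rk : r * k <= e / 2.
    by rewrite -ler_pdivlMr// /r ge_min lexx orbT.
  have r1 : r <= 1 by rewrite /r ge_min lexx.
  apply: le_trans rk; rewrite metric_sym; apply: ler_pM.
  - exact: mdist_ge0.
  - by rewrite addr_ge0 ?mdist_ge0// mulr_ge0// mean_dist_ge0.
  - exact: ltW.
  - by rewrite /k; lra.
lra.
Qed.

(** The variance inequality makes the minimizer unique, so that the default value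
    in [center_of_mass] is not taken. *)
Lemma cm_expectation_center : is_center h (cm_expectation P (h : T -> borel N)).
Proof.
have [c hc] := center_exists.
have minc : cm_minimizers (pushforward P (h : T -> borel N)) = [set c].
  apply/seteqP; split => [x /(_ c c)|_ -> z x].
    rewrite !cm_functionalE energyxx lee_fin => xc; apply: mdist_positivity.
    apply/eqP; rewrite metric_sym -sqrf_eq0 eq_le sqr_ge0 andbT.
    exact: le_trans (variance_inequality catN hc x) xc.
  by rewrite !cm_functionalE lee_fin (energyD z c x) lerDl; exact: hc.
have : cm_minimizers (pushforward P (h : T -> borel N))
    (cm_expectation P (h : T -> borel N)).
  have -> : cm_minimizers (pushforward P (h : T -> borel N)) =
      [set cm_expectation P (h : T -> borel N)].
    by apply: (@getPex _ [set c | cm_minimizers _ = [set c]]); exists c.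
  by [].
move=> H x; have := H (cm_expectation P (h : T -> borel N)) x.
by rewrite !cm_functionalE energyxx lee_fin.
Qed.

End center_existence.

End fixed_map.

(** Adding the variance inequalities for [h] at [c'] and for [h'] at [c], the
    squared distances regroup into differences [d(x, h)^2 - d(x, h')^2], each of
    order [e].  As [e] tends to 0 this forces [c'] to tend to [c]. *)
Lemma center_stability h h' c c' (e : R) : CAT0 N ->
  integrable_map h -> integrable_map h' -> is_center h c -> is_center h' c' ->
  0 <= e -> (forall w, mdist (h w) (h' w) <= e) ->
  mdist c c' ^+ 2 <= e * (mdist c c' + 2 * mean_dist h c + e).
Proof.
move=> catN ih ih' hc hc' e0 hh'.
have v := variance_inequality ih catN hc c'.
have v' := variance_inequality ih' catN hc' c; rewrite metric_sym in v'.
suff : energy h c c' + energy h' c' c <=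
    2 * (e * (mdist c c' + 2 * mean_dist h c + e)) by lra.
have -> : 2 * (e * (mdist c c' + 2 * mean_dist h c + e)) =
    (4 * e) * mean_dist h c + 2 * e * (mdist c c' + e) by ring.
rewrite -Rintegral_affine_dist// -RintegralD//; last 2 first.
- exact: integrable_sqr_dist_diff.
- exact: integrable_sqr_dist_diff.
apply: le_Rintegral => //.
- exact: (integrableD measurableT (integrable_sqr_dist_diff ih c c')
    (integrable_sqr_dist_diff ih' c' c)).
- exact: integrable_affine_dist.
move=> w _.
have near_sqr x : mdist x (h w) ^+ 2 - mdist x (h' w) ^+ 2 <=
    e * (2 * mdist x (h w) + e) /\ mdist x (h' w) ^+ 2 - mdist x (h w) ^+ 2 <=
    e * (2 * mdist x (h w) + e).
  have := sqr_dist_diff (h' w) (h w) x; rewrite !(metric_sym _ x) ler_norml.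
  have le_e : mdist (h' w) (h w) * (2 * mdist x (h w) + mdist (h' w) (h w)) <=
      e * (2 * mdist x (h w) + e).
    have := hh' w; rewrite metric_sym => hw.
    apply: ler_pM; rewrite ?mdist_ge0 ?addr_ge0 ?mulr_ge0 ?mdist_ge0//.
    by rewrite lerD2l.
  lra.
have [? _] := near_sqr c'; have [_ ?] := near_sqr c.
have : e * mdist c' (h w) <= e * (mdist c c' + mdist c (h w)).
  by rewrite ler_wpM2l// (metric_sym c c') metric_triangle.
lra.
Qed.

End center.

(** * Uniformly continuous maps on the product *)

Lemma unif_continuous_mdist (R : realType) (M N : metricType R) (f : M -> N) :
  unif_continuous f -> forall e, 0 < e ->
  exists2 r : R, 0 < r & forall p q, mdist p q < r -> mdist (f p) (f q) < e.
Proof.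
move=> uf e e0; have := uf _ (entourage_ball N (PosNum e0)).
rewrite nbhs_simpl /= -entourage_ballE => -[r r0 H]; exists r => // p q pq.
by have := H (p, q); rewrite /= !ballEmdist; apply.
Qed.

Lemma unif_continuous_preimage_open (R : realType) (M N : metricType R)
    (f : M -> N) (U : set N) : unif_continuous f -> open U -> open (f @^-1` U).
Proof.
move=> /unif_continuous_mdist uf /open_mdistP oU; apply/open_mdistP => x /oU[e e0 eU].
have [r r0 H] := uf e e0; exists r => // y xy; exact/eU/H.
Qed.

Section product.
Variables (R : realType) (X Y : mmSpace R).

Lemma l2prod_mdistE (p q : l2prod X Y) :
  mdist p q = Num.sqrt (mdist p.1 q.1 ^+ 2 + mdist p.2 q.2 ^+ 2).
Proof. by []. Qed.

Lemma l2prod_mdist_le (p q : l2prod X Y) :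
  mdist p q <= mdist p.1 q.1 + mdist p.2 q.2.
Proof.
rewrite l2prod_mdistE -[leRHS]ger0_norm ?addr_ge0 ?mdist_ge0// -sqrtr_sqr.
rewrite ler_wsqrtr// sqrrD.
by have := mulr_ge0 (mdist_ge0 p.1 q.1) (mdist_ge0 p.2 q.2); lra.
Qed.

(** By separability an open set is the union of the countably many boxes inside it
    that have a center in a countable dense set and a radius [1 / (n + 1)]. *)
Lemma open_l2prod_measurable (U : set (l2prod X Y)) :
  open U -> measurable (U : set (borel X * borel Y)).
Proof.
move=> /open_mdistP oU.
have [D1 cD1 dD1] := @mm_separable _ X; have [D2 cD2 dD2] := @mm_separable _ Y.
pose box (i : X * Y * nat) : set (borel X * borel Y) :=
  [set x | mdist i.1.1 x < i.2.+1%:R^-1] `*` [set y | mdist i.1.2 y < i.2.+1%:R^-1].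
pose I := [set i | (D1 `*` D2 `*` setT) i /\ box i `<=` U].
have -> : U = \bigcup_(i in I) box i.
  apply/seteqP; split=> [[x y] Uxy|z [i [_ iU] /iU//]].
  have [e e0 eU] := oU _ Uxy.
  (* Each factor of a box has diameter less than [2 / (n + 1)]. *)
  have [n ne] : exists n, n.+1%:R^-1 < e / 4 :> R.
    exists (Num.bound (e / 4)^-1); rewrite invf_plt ?posrE ?divr_gt0//.
    by rewrite (lt_trans (archi_boundP _))// ?ltr_nat// invr_ge0 divr_ge0// ltW.
  have n0 : 0 < n.+1%:R^-1 :> R by rewrite invr_gt0.
  have [p Dp px] := dense_mdist x dD1 n0; have [q Dq qy] := dense_mdist y dD2 n0.
  exists ((p, q), n) => //; split=> // -[x' y'] [].
  rewrite /= -/(mdist p x' < n.+1%:R^-1) -/(mdist q y' < n.+1%:R^-1) => px' qy'.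
  apply: eU; apply: le_lt_trans (l2prod_mdist_le _ _) _ => /=.
  have := metric_triangle x p x'; have := metric_triangle y q y'.
  rewrite (metric_sym x p) (metric_sym y q).
  move: ne px qy px' qy'; move: n.+1%:R^-1 => k; lra.
rewrite bigcup_set_type; apply: countable_bigcupT_measurable.
  rewrite (eq_countable (card_setT _)).
  apply: (@sub_countable _ _ _ (D1 `*` D2 `*` setT)).
    by apply: subset_card_le => i [].
  by apply: countableX => //; exact: countableX.
by move=> i; apply: measurableX; exact: measurable_mball.
Qed.

Variables (N : completeMetricType R) (f : l2prod X Y -> N).
Hypothesis uf : unif_continuous f.

Lemma measurable_l2prod_map :
  measurable_fun setT (f : borel X * borel Y -> borel N).
Proof.
apply: measurable_to_borel => U oU; apply: open_l2prod_measurable.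
exact: unif_continuous_preimage_open.
Qed.

Lemma measurable_l2prod_section (y : Y) :
  measurable_fun setT ((fun x => f (x, y)) : borel X -> borel N).
Proof.
have mp : measurable_fun setT (fun x : borel X => (x, y : borel Y)).
  by apply: measurable_fun_pair => //; exact: measurable_cst.
exact: (measurableT_comp measurable_l2prod_map mp).
Qed.

Lemma section_mdist e : 0 < e -> exists2 r : R, 0 < r &
  forall y y', mdist y y' < r -> forall x, mdist (f (x, y)) (f (x, y')) < e.
Proof.
move=> /(unif_continuous_mdist uf)[r r0 H]; exists r => // y y' yy' x.
by apply: H; apply: le_lt_trans (l2prod_mdist_le _ _) _; rewrite /= mdistxx add0r.
Qed.

Hypothesis mom :
  finite_moment1 (pushforward (mm_prod_measure X Y) (f : borel X * borel Y -> borel N)).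

Lemma integrable_l2prod_map : @integrable_map _ (borel X * borel Y)%type _
  (mm_prod_measure X Y) N f.
Proof.
apply: integrable_mapP; first exact: measurable_l2prod_map.
case: mom => x hx; exists x; move: hx.
rewrite (ge0_integral_pushforward measurable_l2prod_map)//.
  by apply/measurable_EFinP; exact: measurable_mdist.
by move=> y _; rewrite lee_fin mdist_ge0.
Qed.

Lemma fubini_mdist (F : N -> \bar R) : (forall z, 0 <= F z)%E ->
    measurable_fun setT (F : borel N -> \bar R) ->
  (\int[mm_prod_measure X Y]_w F (f w) =
   \int[mm_measure Y]_y \int[mm_measure X]_x F (f (x, y)))%E.
Proof.
move=> F0 mF; have mFf : measurable_fun setT (fun w : borel X * borel Y => F (f w)).
  exact: (measurableT_comp mF measurable_l2prod_map).
have := @fubini_tonelli2 _ _ (borel X) (borel Y) R (mm_measure X) (mm_measure Y) _ mFf.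
by rewrite /fubini_G; apply => w; exact: F0.
Qed.

(** If the mean of [d(z0, f(x, y'))] over [x] were infinite for all [y'] near [y],
    a set of positive measure since [mu_Y] has full support, Fubini would make the
    moment of [f] infinite.  So some nearby fiber is integrable, and by uniform
    continuity the fiber over [y] is within distance 1 of it. *)
Lemma integrable_l2prod_section (y : Y) : @integrable_map _ (borel X) _
  (mm_measure X) N (fun x => f (x, y)).
Proof.
apply: integrable_mapP; first exact: measurable_l2prod_section.
pose z0 : N := point; pose M y := (\int[mm_measure X]_x (mdist z0 (f (x, y)))%:E)%E.
have [r r0 H] := section_mdist ltr01; pose U := [set y' | mdist y y' < r].
have mU : measurable (U : set (borel Y)) by exact: measurable_mball.
have U0 : (0 < mm_measure Y U)%E.
  have : measure_support (mm_measure Y) y by rewrite mm_full_support.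
  apply; last by rewrite /U /= mdistxx.
  apply/open_mdistP => y' /= yy'; exists (r - mdist y y'); first by rewrite subr_gt0.
  by move=> z yz; rewrite /U /=; have := metric_triangle y y' z; lra.
have [y' Uy' My'] : exists2 y', U y' & (M y' < +oo)%E.
  apply: contrapT => HM.
  have MU y' : U y' -> M y' = +oo%E.
    by move=> Uy'; apply: contrapT => My'; apply: HM; exists y' => //; rewrite ltey; exact/eqP.
  have : (\int[mm_measure Y]_y M y = +oo)%E.
    apply/eqP; rewrite -leye_eq.
    have <- : (\int[mm_measure Y]_(y in U) cst +oo y)%E = +oo%E :> \bar R.
      by rewrite integral_cst// gt0_mulye.
    rewrite integral_mkcond; apply: ge0_le_integral_sup => y'; rewrite patchE.
      by case: ifP; rewrite ?leey.
    case: ifPn => [/set_mem/MU ->//|_].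
    by apply: integral_ge0 => x _; rewrite lee_fin mdist_ge0.
  apply/eqP; rewrite -ltey /M.
  rewrite -(fubini_mdist (F := fun z => (mdist z0 z)%:E)).
  - by rewrite (mean_distE integrable_l2prod_map) ltry.
  - by move=> z; rewrite lee_fin mdist_ge0.
  - by apply/measurable_EFinP; exact: measurable_mdist.
exists z0.
have m_sec y1 : measurable_fun setT
    (fun x : borel X => (mdist z0 (f (x, y1)))%:E).
  apply/measurable_EFinP; apply: measurable_mdist_comp.
  exact: measurable_l2prod_section.
have : (\int[mm_measure X]_x ((mdist z0 (f (x, y')))%:E + 1%:E) < +oo)%E.
  rewrite ge0_integralD//; last by move=> x _; rewrite lee_fin mdist_ge0.
  by rewrite integral_cst_probability lte_add_pinfty// ltry.
apply: le_lt_trans; apply: ge0_le_integral_sup => x; rewrite ?lee_fin ?mdist_ge0//.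
apply: le_trans (metric_triangle _ (f (x, y')) _) _.
rewrite lerD2l ltW// metric_sym; exact: H.
Qed.

(** * The two expectations *)

Hypothesis catN : CAT0 N.

Definition fiber_center (y : Y) : N :=
  cm_expectation (mm_measure X) ((fun x => f (x, y)) : borel X -> borel N).

Lemma fiber_center_center y : @is_center _ (borel X) _ (mm_measure X) N
  (fun x => f (x, y)) (fiber_center y).
Proof. exact: (cm_expectation_center (integrable_l2prod_section y) catN). Qed.

(** With [D] the distance between the two centers, [m] the mean distance of the
    fiber to its center and [u] the uniform distance between the fibers,
    [center_stability] reads [D^2 <= u (D + 2 m + u)].  Since [u <= 1] and
    [u (e + 2 m + 1) <= e^2 / 2], this is incompatible with [D >= e]. *)
Lemma fiber_center_continuous y e : 0 < e -> exists2 r : R, 0 < r &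
  forall y', mdist y y' < r -> mdist (fiber_center y) (fiber_center y') < e.
Proof.
move=> e0; pose m := @mean_dist _ (borel X) _ (mm_measure X) _
  (fun x => f (x, y)) (fiber_center y).
have m0 : 0 <= m by exact: mean_dist_ge0.
pose k := e + 2 * m + 1; have k0 : 0 < k by rewrite /k; lra.
pose u := Num.min 1 (e ^+ 2 / k / 2).
have u0 : 0 < u by rewrite lt_min ltr01 !divr_gt0// exprn_gt0.
have u1 : u <= 1 by rewrite /u ge_min lexx.
have uk : u * k <= e ^+ 2 / 2.
  by rewrite -ler_pdivlMr// /u mulrAC ge_min lexx orbT.
have [r r0 H] := section_mdist u0; exists r => // y' yy'.
have := center_stability catN (integrable_l2prod_section y)
  (integrable_l2prod_section y') (fiber_center_center y)
  (fiber_center_center y') (ltW u0) (fun w => ltW (H _ _ yy' w)).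
rewrite -/m; move: (mdist _ _) (mdist_ge0 (fiber_center y) (fiber_center y')) => D D0 DD.
rewrite ltNge; apply/negP => eD.
have : e * D <= D * D by rewrite ler_wpM2r.
have : e * e <= D * e by rewrite ler_wpM2r// ltW.
have : u * (2 * m + u) <= u * (2 * m + 1) by rewrite ler_pM2l//; lra.
have : u * D <= e * D / 2.
  rewrite -mulrA (mulrC D) mulrA ler_wpM2r//.
  have : u * e <= u * k by rewrite ler_pM2l// /k; lra.
  move=> ue; have : e * u <= e * (e / 2) by lra.
  by rewrite ler_pM2l.
have := sqr_ge0 e; rewrite /k in uk.
have : 0 < u * e by rewrite mulr_gt0.
lra.
Qed.

Lemma measurable_fiber_center :
  measurable_fun setT (fiber_center : borel Y -> borel N).
Proof.
apply: measurable_to_borel => U oU; apply: borel_open; apply/open_mdistP => y.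
move: oU => /open_mdistP oU /oU[e e0 eU].
have [r r0 H] := fiber_center_continuous y e0.
by exists r => // y' /H/eU.
Qed.

Lemma fiber_center_mdist_le z y :
  ((mdist z (fiber_center y))%:E <=
   \int[mm_measure X]_x (mdist z (f (x, y)))%:E)%E.
Proof.
rewrite (mean_distE (integrable_l2prod_section y)) lee_fin metric_sym.
exact: (mdist_center_le_mean (integrable_l2prod_section y) catN (fiber_center_center y)).
Qed.

Lemma fiber_center_mean_le z :
  (\int[mm_measure Y]_y (mdist z (fiber_center y))%:E <=
   \int[mm_prod_measure X Y]_w (mdist z (f w))%:E)%E.
Proof.
rewrite (fubini_mdist (F := fun x => (mdist z x)%:E)).
- by apply: ge0_le_integral_sup => y; [rewrite lee_fin mdist_ge0|exact: fiber_center_mdist_le].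
- by move=> x; rewrite lee_fin mdist_ge0.
- by apply/measurable_EFinP; exact: measurable_mdist.
Qed.

Lemma integrable_fiber_center :
  @integrable_map _ (borel Y) _ (mm_measure Y) N fiber_center.
Proof.
apply: integrable_mapP; first exact: measurable_fiber_center.
exists point; apply: le_lt_trans (fiber_center_mean_le _) _.
by rewrite (mean_distE integrable_l2prod_map) ltry.
Qed.

Let c : N := cm_expectation (mm_prod_measure X Y) (f : borel X * borel Y -> borel N).
Let e : N := cm_expectation (mm_measure Y) (fiber_center : borel Y -> borel N).

Let hc : @is_center _ (borel X * borel Y)%type _ (mm_prod_measure X Y) N f c.
Proof. exact: (cm_expectation_center integrable_l2prod_map catN). Qed.

Let he : @is_center _ (borel Y) _ (mm_measure Y) N fiber_center e.
Proof. exact: (cm_expectation_center integrable_fiber_center catN). Qed.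

Lemma mdist_expectations_le_mean :
  ((mdist c e)%:E <= \int[mm_prod_measure X Y]_w (mdist c (f w))%:E)%E.
Proof.
apply: le_trans (fiber_center_mean_le c).
rewrite (mean_distE integrable_fiber_center) lee_fin metric_sym.
exact: (mdist_center_le_mean integrable_fiber_center catN he).
Qed.

(** With [A z] and [Q z] the second moments of [g] and [f] about [z], the
    variance inequality for the fibers and [d(e, f)^2 <= 2 d(e, g)^2 + 2 d(g, f)^2]
    give [2 A c + Q e <= 2 Q c + 2 A e]; the term [int d(g, f)^2] is eliminated
    fiber by fiber, before integrating over [Y].  Together with
    [D^2 + Q c <= Q e] and [D^2 + A e <= A c] this yields [3 D^2 <= Q c]. *)
Lemma mdist_expectations_le_second_moment :
  ((3 * mdist c e ^+ 2)%:E <= \int[mm_prod_measure X Y]_w (mdist c (f w) ^+ 2)%:E)%E.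
Proof.
have m2 z : measurable_fun setT (fun y : borel N => (mdist z (y : N) ^+ 2)%:E).
  by apply/measurable_EFinP; apply: measurable_funX; exact: measurable_mdist.
have p2 z (y : N) : (0 <= (mdist z y ^+ 2)%:E)%E by rewrite lee_fin sqr_ge0.
pose Q z := (\int[mm_prod_measure X Y]_w (mdist z (f w) ^+ 2)%:E)%E.
pose q z y := (\int[mm_measure X]_x (mdist z (f (x, y)) ^+ 2)%:E)%E.
pose A z := (\int[mm_measure Y]_y (mdist z (fiber_center y) ^+ 2)%:E)%E.
have QE z : Q z = (\int[mm_measure Y]_y q z y)%E.
  exact: (fubini_mdist (F := fun x => (mdist z x ^+ 2)%:E)).
have q0 z y : (0 <= q z y)%E by apply: integral_ge0 => x _.
have mq z : measurable_fun setT (q z : borel Y -> \bar R).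
  apply: (@measurable_fun_fubini_tonelli_G _ _ (borel X) (borel Y) R (mm_measure X)
    (fun w => (mdist z (f w) ^+ 2)%:E)); last by move=> w; exact: p2.
  exact: (measurableT_comp (m2 z) measurable_l2prod_map).
have mg z : measurable_fun setT (fun y : borel Y => (mdist z (fiber_center y) ^+ 2)%:E).
  exact: (measurableT_comp (m2 z) measurable_fiber_center).
have Qce : ((mdist c e ^+ 2)%:E + Q c <= Q e)%E.
  exact: (variance_inequality_ereal integrable_l2prod_map catN hc e).
have Aec : ((mdist c e ^+ 2)%:E + A e <= A c)%E.
  rewrite metric_sym.
  exact: (variance_inequality_ereal integrable_fiber_center catN he c).
have qV y : ((mdist c (fiber_center y) ^+ 2)%:E + q (fiber_center y) y <= q c y)%E.
  rewrite metric_sym.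
  exact: (variance_inequality_ereal (integrable_l2prod_section y) catN (fiber_center_center y) c).
have mf z y : measurable_fun setT (fun x : borel X => (mdist z (f (x, y)) ^+ 2)%:E).
  exact: (measurableT_comp (m2 z) (measurable_l2prod_section y)).
have qe y : (q e y <= 2%:E * (mdist e (fiber_center y) ^+ 2)%:E +
                      2%:E * q (fiber_center y) y)%E.
  rewrite -ge0_integralZl//.
  rewrite -[X in (X + _)%E](integral_cst_probability (mm_measure X)).
  rewrite -ge0_integralD//; last first.
  - exact: measurable_funeM.
  - by move=> x _; rewrite mule_ge0.
  - by move=> x _; rewrite mule_ge0.
  apply: ge0_le_integral_sup => // x; rewrite -!EFinM -EFinD lee_fin.
  set p := fiber_center y; set r := f (x, y).
  have : mdist e r ^+ 2 <= (mdist e p + mdist p r) ^+ 2.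
    by rewrite ler_sqr ?nnegrE ?addr_ge0 ?mdist_ge0// metric_triangle.
  by have := sqr_ge0 (mdist e p - mdist p r); lra.
have int2 (u v : borel Y -> \bar R) : measurable_fun setT u ->
    measurable_fun setT v -> (forall y, 0 <= u y)%E -> (forall y, 0 <= v y)%E ->
    (\int[mm_measure Y]_y (2%:E * u y + v y) =
     2%:E * \int[mm_measure Y]_y u y + \int[mm_measure Y]_y v y)%E.
  move=> mu mv u0 v0; rewrite ge0_integralD//.
  - by rewrite ge0_integralZl.
  - by move=> y _; rewrite mule_ge0.
  - exact: measurable_funeM.
have AQ : (2%:E * A c + Q e <= 2%:E * Q c + 2%:E * A e)%E.
  have L : (2%:E * A c + Q e = \int[mm_measure Y]_y
      (2%:E * (mdist c (fiber_center y) ^+ 2)%:E + q e y))%E.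
    rewrite [RHS](int2 _ _ (mg c) (mq e) (fun=> p2 _ _) (q0 e)).
    by congr (_ + _)%E; exact: QE.
  have L' : (2%:E * Q c + 2%:E * A e = \int[mm_measure Y]_y
      (2%:E * q c y + 2%:E * (mdist e (fiber_center y) ^+ 2)%:E))%E.
    rewrite int2//; last 2 first.
    - exact: measurable_funeM.
    - by move=> y; rewrite mule_ge0.
    by rewrite (QE c); congr (_ + _)%E; rewrite ge0_integralZl.
  rewrite [leLHS]L [leRHS]L'.
  apply: ge0_le_integral_sup => y; first by rewrite adde_ge0// mule_ge0.
  apply: (@le_trans _ _ (2%:E * (mdist c (fiber_center y) ^+ 2)%:E +
    (2%:E * (mdist e (fiber_center y) ^+ 2)%:E + 2%:E * q (fiber_center y) y))%E).
    by rewrite leeD2l.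
  rewrite addeCA addeC -ge0_muleDr//.
  by rewrite leeD2r// lee_pmul2l.
have AcQ : (A c <= Q c)%E.
  rewrite QE; apply: ge0_le_integral_sup => // y.
  by apply: le_trans (qV y); rewrite leeDl.
have A0 z : (0 <= A z)%E by apply: integral_ge0 => y _.
have Q0 z : (0 <= Q z)%E by apply: integral_ge0 => w _.
rewrite -/(Q c); move: Qce Aec AQ AcQ (A0 c) (A0 e) (Q0 c) (Q0 e).
case: (Q c) => [Qc| |]; rewrite ?leey//; case: (A c) => [Ac| |] //.
case: (A e) => [Ae| |] //; case: (Q e) => [Qe| |] //.
rewrite -?EFinM -?EFinD !lee_fin; lra.
Qed.

End product.

Theorem theorem1p1 (R : realType) (N : completeMetricType R) (X Y : mmSpace R)
    (f : l2prod X Y -> N) :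
  let muX := mm_measure X in
  let muY := mm_measure Y in
  let muXY := mm_prod_measure X Y in
  let Ef := cm_expectation muXY f in
  let g := fun y : Y => cm_expectation muX (fun x : X => f (x, y)) in
  let EEf := cm_expectation muY g in
  CAT0 N ->
  unif_continuous f ->
  finite_moment1 (pushforward muXY (f : borel X * borel Y -> borel N)) ->
  ((mdist Ef EEf)%:E <= Lp_variation muXY 1 f)%E /\
  ((mdist Ef EEf)%:E <= (1 / Num.sqrt 3)%:E * Lp_variation muXY 2 f)%E.
Proof.
move=> muX muY muXY Ef g EEf catN uf mom.
have ih := integrable_l2prod_map uf mom.
have hc : @is_center _ (borel X * borel Y)%type _ muXY N f Ef.
  exact: (cm_expectation_center ih catN).
have V0 p w : (0 <= \int[muXY]_w' (mdist (f w) (f w') `^ p)%:E)%E.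
  by apply: integral_ge0 => w' _; rewrite lee_fin powR_ge0.
have VV0 p : (0 <= \int[muXY]_w \int[muXY]_w' (mdist (f w) (f w') `^ p)%:E)%E.
  by apply: integral_ge0.
split.
  rewrite /Lp_variation invr1 poweRe1//.
  apply: (le_trans (mdist_expectations_le_mean uf mom catN)).
  apply: ge0_le_integral_sup => w; first by rewrite lee_fin mdist_ge0.
  have -> : (\int[muXY]_w' (mdist (f w) (f w') `^ 1)%:E =
             \int[muXY]_w' (mdist (f w) (f w'))%:E)%E.
    by apply: eq_integral => w' _; rewrite powRr1 ?mdist_ge0.
  by rewrite (mean_distE ih) lee_fin; exact: (mdist_center_le_mean ih catN hc).
rewrite /Lp_variation.
set I := (\int[muXY]_w \int[muXY]_w' _)%E.
have I3 : ((3 * mdist Ef EEf ^+ 2)%:E <= I)%E.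
  apply: (le_trans (mdist_expectations_le_second_moment uf mom catN)).
  apply: ge0_le_integral_sup => w; first by rewrite lee_fin sqr_ge0.
  have -> : (\int[muXY]_w' (mdist (f w) (f w') `^ 2)%:E =
             \int[muXY]_w' (mdist (f w) (f w') ^+ 2)%:E)%E.
    by apply: eq_integral => w' _; rewrite powR_mulrn ?mdist_ge0.
  apply: le_trans (variance_inequality_ereal ih catN hc (f w)).
  by rewrite leeDl// integral_ge0// => w' _; rewrite lee_fin sqr_ge0.
have s3 : 0 < Num.sqrt 3 :> R by rewrite sqrtr_gt0.
have := VV0 2; rewrite -/I; case: I I3 => [i| |] //= I3 I0.
  rewrite -EFinM lee_fin mul1r mulrC ler_pdivlMr// powR12_sqrt//.
  rewrite -(ger0_norm (mdist_ge0 Ef EEf)) -sqrtr_sqr -sqrtrM ?sqr_ge0//.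
  by rewrite ler_wsqrtr// mulrC.
by rewrite invr_eq0 pnatr_eq0/= gt0_muley ?leey// lte_fin divr_gt0.
Qed.
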